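(* Let $G$ be a finite partial cube with the opposite-semicube Helly property. Then $G$ is harmonic-even if and only if $G$ is opposite-semicube-isomorphic.
   Context: All graphs are undirected, connected, simple and finite; $d_G$ is the usual shortest-path distance. A partial cube is a graph isomorphic to an isometric subgraph of some hypercube (a subgraph $H$ of $Q$ is isometric if $d_H(x,y)=d_Q(x,y)$ for all $x,y\in V(H)$). The Djokovi\'c–Winkler relation on $E(G)$ is: $uv\,\Theta\,xy$ iff $d_G(u,x)+d_G(v,y)\ne d_G(u,y)+d_G(v,x)$; in a partial cube it is an equivalence relation, and its classes $E_1,\dots,E_d$ are the $\Theta$-classes. For a $\Theta$-class $E_i$ and an edge $xy\in E_i$, the two (opposite) semicubes associated with $E_i$ are $W_i^0=\{a\in V(G): d_G(x,a)<d_G(y,a)\}$ and $W_i^1=\{a\in V(G): d_G(y,a)<d_G(x,a)\}$ (independent of the choice of $xy\in E_i$ up to interchanging the labels $0,1$; they partition $V(G)$). For $x\in V(G)$, $W_i(x)$ denotes the one of $W_i^0,W_i^1$ containing $x$, and $W_i^*(x)$ the other one. $G$ is opposite-semicube-isomorphic if $G[W_i^0]\cong G[W_i^1]$ (induced subgraphs) for every $i\in\{1,\dots,d\}$. $G$ has the opposite-semicube Helly property if for every $x\in V(G)$: whenever $W_i^*(x)\cap W_j^*(x)\ne\emptyset$ for all $1\le i,j\le d$ with $i\ne j$, we have $\bigcap_{i=1}^d W_i^*(x)\ne\emptyset$. An absolute antipode of $x$ is a vertex at distance $\operatorname{diam}(G)$ from $x$. $G$ is even if every vertex $x$ has a unique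 absolute antipode $\bar x$, and harmonic-even if it is even and the map $x\mapsto\bar x$ is an automorphism of $G$. *)

(* Defs.v *)
(* MathComp *)
From mathcomp Require Import all_boot.

Set Implicit Arguments.
Unset Strict Implicit.
Unset Printing Implicit Defensive.

Record sgraph := SGraph {
  vertex :> finType;
  adj : rel vertex;
  adj_sym : symmetric adj;
  adj_irrefl : irreflexive adj
}.

Definition connected (G : sgraph) : Prop :=
  forall x y : G, connect (@adj G) x y.

Definition isomorphism (G H : sgraph) (f : G -> H) : Prop :=
  bijective f /\ forall x y : G, adj (f x) (f y) = adj x y.

Definition isomorphic (G H : sgraph) : Prop :=
  exists f : G -> H, isomorphism f.

Definition walk (G : sgraph) (n : nat) (x y : G) : bool :=
  [exists p : n.-tuple G, path (@adj G) x p && (last x p == y)].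

(* The least n such that there is a walk of length n from x to y; a shortest
   walk has fewer than #|G| edges, so the value #|G| means that x and y are in
   different components. *)
Definition dist (G : sgraph) (x y : G) : nat :=
  find (fun n => walk n x y) (iota 0 #|G|).

Definition diam (G : sgraph) : nat := \max_(x : G) \max_(y : G) dist x y.

(* Subgraphs need not be induced; [subgraph_sgraph] turns one into a graph in
   its own right, so that [dist] is then its own distance. *)
Record subgraph (G : sgraph) := Subgraph {
  sub_vertices : {set G};
  sub_adj : rel G;
  sub_adj_sym : symmetric sub_adj;
  sub_adjP : forall x y, sub_adj x y ->
    [/\ x \in sub_vertices, y \in sub_vertices & adj x y]
}.

Section SubgraphGraph.
Variables (G : sgraph) (H : subgraph G).

Definition subgraph_rel : rel {x : G | x \in sub_vertices H} :=
  fun x y => sub_adj H (val x) (val y).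

Lemma subgraph_rel_sym : symmetric subgraph_rel.
Proof. by move=> x y; rewrite /subgraph_rel sub_adj_sym. Qed.

Lemma subgraph_rel_irrefl : irreflexive subgraph_rel.
Proof.
move=> x; apply/negP => /sub_adjP [_ _].
by rewrite adj_irrefl.
Qed.

Definition subgraph_sgraph : sgraph :=
  SGraph subgraph_rel_sym subgraph_rel_irrefl.

End SubgraphGraph.

Coercion subgraph_sgraph : subgraph >-> sgraph.

Section Induced.
Variables (G : sgraph) (A : {set G}).

Definition induced_rel : rel G :=
  fun x y => [&& x \in A, y \in A & adj x y].

Lemma induced_rel_sym : symmetric induced_rel.
Proof. by move=> x y; rewrite /induced_rel adj_sym andbCA. Qed.

Lemma induced_relP x y :
  induced_rel x y -> [/\ x \in A, y \in A & adj x y].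
Proof. by move/and3P. Qed.

Definition induced : subgraph G := Subgraph induced_rel_sym induced_relP.

End Induced.

Section Hypercube.
Variable n : nat.

Definition hypercube_rel : rel {ffun 'I_n -> bool} :=
  fun u v => #|[set i | u i != v i]| == 1.

Lemma hypercube_rel_sym : symmetric hypercube_rel.
Proof.
move=> u v; rewrite /hypercube_rel; congr (#|pred_of_set _| == 1).
by apply/setP => i; rewrite !inE eq_sym.
Qed.

Lemma hypercube_rel_irrefl : irreflexive hypercube_rel.
Proof.
move=> u; apply/negbTE; rewrite /hypercube_rel (_ : [set i | _] = set0).
  by rewrite cards0.
by apply/setP => i; rewrite !inE eqxx.
Qed.

Definition hypercube : sgraph := SGraph hypercube_rel_sym hypercube_rel_irrefl.

End Hypercube.

Definition isometric (Q : sgraph) (H : subgraph Q) : Prop :=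
  forall x y : H, dist x y = dist (val x) (val y).

Definition partial_cube (G : sgraph) : Prop :=
  exists (n : nat) (H : subgraph (hypercube n)), isometric H /\ isomorphic G H.

Section PartialCubeNotions.
Variable G : sgraph.

Definition edges : {set {set G}} :=
  [set [set xy.1; xy.2] | xy : G * G & adj xy.1 xy.2].

(* The inequality is invariant under swapping u and v, or x and y, so it does
   not depend on how the two edges are oriented. *)
Definition theta : rel {set G} := fun e f =>
  [exists u, exists v, exists x, exists y,
    [&& e == [set u; v], f == [set x; y]
      & dist u x + dist v y != dist u y + dist v x]].

Definition theta_classes : {set {set {set G}}} :=
  equivalence_partition theta edges.

Definition closer (x y : G) : {set G} := [set a | dist x a < dist y a].

(* The opposite semicubes (W^0, W^1) of a Theta-class C, computed from one
   oriented edge of C; in a partial cube another choice can only swap them.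
   The default is used only when C contains no edge. *)
Definition semicubes (C : {set {set G}}) : {set G} * {set G} :=
  if [pick xy : G * G | [set xy.1; xy.2] \in C] is Some xy
  then (closer xy.1 xy.2, closer xy.2 xy.1) else (set0, set0).

(* W_C^*(x): the semicube of C that does not contain x. *)
Definition opp_semicube (C : {set {set G}}) (x : G) : {set G} :=
  if x \in (semicubes C).1 then (semicubes C).2 else (semicubes C).1.

Definition opposite_semicube_isomorphic : Prop :=
  forall C, C \in theta_classes ->
    isomorphic (induced (semicubes C).1) (induced (semicubes C).2).

Definition opposite_semicube_Helly : Prop :=
  forall x : G,
    (forall C D, C \in theta_classes -> D \in theta_classes -> C != D ->
       opp_semicube C x :&: opp_semicube D x != set0) ->
    \bigcap_(C in theta_classes) opp_semicube C x != set0.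

Definition absolute_antipode (x y : G) : bool := dist x y == diam G.

Definition even : Prop := forall x : G, exists! y : G, absolute_antipode x y.

(* The map sending x to its antipode when [even] holds. *)
Definition antipode (x : G) : G := odflt x [pick y | absolute_antipode x y].

Definition harmonic_even : Prop := even /\ isomorphism antipode.

End PartialCubeNotions.

(* Main.v *)
(* Embed G isometrically in a hypercube; Theta-classes are then the coordinates
   that are not constant on G, and distance counts the coordinates that differ.
   If G is harmonic-even, taking antipodes flips every such coordinate, hence
   exchanges opposite semicubes.  Conversely, isomorphic opposite semicubes have
   equal cardinalities, which already makes the Helly condition applicable at
   every vertex x and yields a vertex differing from x in every class; flipping
   all classes is an isometry, and it is the antipodal map. *)
Require Import Defs.
From mathcomp Require Import all_boot.

Set Implicit Arguments.
Unset Strict Implicit.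
Unset Printing Implicit Defensive.

(** * Walks and graph distance *)

Lemma dist_eqP (G : sgraph) (x y : G) n :
  n < #|G| -> walk n x y -> (forall m, walk m x y -> n <= m) -> dist x y = n.
Proof.
move=> ltnG wn minn; rewrite /dist.
set a := (fun m => _).
(* The bound [n < #|G|] puts [n] in the list searched by [dist], so the search does not end with the
   default [#|G|]. *)
have has_a : has a (iota 0 #|G|).
  by apply/hasP; exists n; rewrite ?mem_iota.
have lt_find : find a (iota 0 #|G|) < #|G|.
  by rewrite -{2}(size_iota 0 #|G|) -has_find.
apply/eqP; rewrite eqn_leq; apply/andP; split.
  rewrite leqNgt; apply/negP => /(before_find 0).
  by rewrite nth_iota // add0n /a wn.
by apply: minn; have := nth_find 0 has_a; rewrite nth_iota.
Qed.

Lemma walk0 (G : sgraph) (x y : G) : walk 0 x y = (x == y).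
Proof.
apply/existsP/idP => [[p]|xy]; first by rewrite tuple0.
by exists [tuple].
Qed.

Lemma walk1 (G : sgraph) (x y : G) : walk 1 x y = adj x y.
Proof.
apply/existsP/idP => [[p]|xy].
  by case/tupleP: p => z p; rewrite tuple0 /= andbT => /andP[xz /eqP <-].
by exists [tuple y]; rewrite /= xy eqxx.
Qed.

Lemma walkS (G : sgraph) n (x y : G) :
  walk n.+1 x y = [exists z, adj x z && walk n z y].
Proof.
apply/existsP/existsP => [[p]|[z /andP[xz /existsP[p pP]]]].
  case/tupleP: p => z p /= /andP[/andP[xz zp] lp].
  by exists z; rewrite xz; apply/existsP; exists p; rewrite zp.
by exists [tuple of z :: p]; rewrite /= xz.
Qed.

Lemma dist_eq0 (G : sgraph) (x y : G) : (dist x y == 0) = (x == y).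
Proof.
rewrite -walk0 /dist; have: 0 < #|G| by apply/card_gt0P; exists x.
by case: #|G| => //= m _; case: walk.
Qed.

Lemma dist_eq1 (G : sgraph) (x y : G) : (dist x y == 1) = adj x y.
Proof.
have [->|neq_xy] := eqVneq x y.
  by rewrite adj_irrefl; have /eqP-> : dist y y == 0 by rewrite dist_eq0.
(* Two distinct vertices bring length 1 into the searched range, so the value [#|G|] of a failed
   search cannot be mistaken for 1. *)
have: 1 < #|G| by have := max_card [set x; y]; rewrite cards2 neq_xy.
rewrite -walk1 /dist; case: #|G| => [|[|m]] //= _.
by rewrite walk0 (negbTE neq_xy); case: walk.
Qed.

Lemma isomorphism_dist (G H : sgraph) (f : G -> H) x y :
  isomorphism f -> dist (f x) (f y) = dist x y.
Proof.
case=> bij_f adj_f; rewrite /dist (bij_eq_card bij_f); apply: eq_find => n /=.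
case: bij_f => g fK gK.
elim: n x => [|n IHn] x; first by rewrite !walk0 (can_eq fK).
rewrite !walkS; apply/existsP/existsP => [[z]|[z]].
  by rewrite -(gK z) adj_f IHn; exists (g z).
by exists (f z); rewrite adj_f IHn.
Qed.

(** * Induced subgraphs and edges as unordered pairs *)

Lemma isomorphic_induced (G : sgraph) (h : G -> G) (A B : {set G}) :
  isomorphism h -> (forall x, (h x \in B) = (x \in A)) ->
  isomorphic (induced A) (induced B).
Proof.
case=> -[g hK gK] adj_h hAB.
have hB (x : induced A) : h (val x) \in B by rewrite hAB (valP x).
have gA (y : induced B) : g (val y) \in A by rewrite -hAB gK (valP y).
exists (fun x => exist _ (h (val x)) (hB x)); split.
  exists (fun y => exist _ (g (val y)) (gA y)) => x; apply: val_inj => /=.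
    exact: hK.
  exact: gK.
move=> x y; rewrite /= /subgraph_rel /= /induced_rel /=.
by rewrite !hAB adj_h.
Qed.

Lemma isomorphic_induced_card (G : sgraph) (A B : {set G}) :
  isomorphic (induced A) (induced B) -> #|A| = #|B|.
Proof.
by case=> f [/bij_eq_card]; rewrite !card_sig.
Qed.

Lemma adj_in_edges (G : sgraph) (x y : G) : ([set x; y] \in edges G) = adj x y.
Proof.
apply/imsetP/idP => [[[u v] /=]|xy]; last by exists (x, y); rewrite ?inE.
rewrite inE /= => uv /setP eq_xy.
(* Of the four ways to match [x] and [y] with [u] and [v], two give the edge and two would make it a
   loop. *)
have := eq_xy u; have := eq_xy v; have := eq_xy x; have := eq_xy y.
rewrite !inE !eqxx ?orbT /=.
do 2!move/esym/orP => [] /eqP ->; rewrite ?eqxx ?orbT ?orbb //.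
- by move/eqP=> vu; move: uv; rewrite vu adj_irrefl.
- by rewrite adj_sym.
- by move=> _ /eqP vu; move: uv; rewrite vu adj_irrefl.
Qed.

(** * Hypercube distance and isometric embeddings *)

Definition hamming n (u v : 'I_n -> bool) : nat := \sum_k (u k != v k).

Lemma hammingE n (u v : {ffun 'I_n -> bool}) :
  hamming u v = #|[set k | u k != v k]|.
Proof.
rewrite /hamming -sum1dep_card [RHS]big_mkcond; apply: eq_bigr => k _.
by case: (_ != _).
Qed.

(** Correcting the differing coordinates one at a time gives a walk of this length, within the
    search range since n < 2^n. No walk is shorter, because each step changes a single
    coordinate. *)
Lemma dist_hypercube n (u v : hypercube n) :
  dist u v = hamming (u : {ffun _}) (v : {ffun _}).
Proof.
apply: dist_eqP.
- rewrite card_ffun card_bool card_ord.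
  apply: leq_ltn_trans (ltn_expl n (ltnSn 1)).
  by rewrite hammingE -[leqRHS]card_ord max_card.
- rewrite hammingE; move: {2}#|_| (erefl #|[set k | u k != v k]|) => m.
  elim: m u => [|m IHm] u card_uv; rewrite card_uv.
    rewrite walk0; apply/eqP/ffunP => k; apply/eqP/negPn.
    by move/cards0_eq/setP/(_ k): card_uv; rewrite !inE => ->.
  have /card_gt0P[k]: 0 < #|[set k | u k != v k]| by rewrite card_uv.
  rewrite inE => neq_k; rewrite walkS.
  pose w : {ffun 'I_n -> bool} := [ffun j => if j == k then v k else u j].
  have uw : [set j | u j != w j] = [set k].
    apply/setP => j; rewrite !inE ffunE.
    by case: (eqVneq j k) => [->|_]; rewrite ?eqxx.
  have wv : [set j | w j != v j] = [set j | u j != v j] :\ k.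
    apply/setP => j; rewrite !inE ffunE.
    by case: (eqVneq j k) => [->|_]; rewrite ?eqxx.
  have card_wv : #|[set j | w j != v j]| = m.
    by apply/eqP; rewrite -eqSS -card_uv wv [eqbRHS](cardsD1 k) inE neq_k.
  apply/existsP; exists w; rewrite -[X in walk X]card_wv IHm // andbT.
  by rewrite /= /hypercube_rel uw cards1.
- move=> m; elim: m u => [|m IHm] u.
    by rewrite walk0 => /eqP->; rewrite /hamming big1 // => k _; rewrite eqxx.
  rewrite walkS => /existsP[w /andP[uw /IHm wv]].
  apply: leq_trans (_ : hamming u w + hamming w v <= _).
    rewrite /hamming -big_split leq_sum // => k _ /=.
    by do 3!case: (_ k).
  by move: uw; rewrite /= /hypercube_rel -hammingE => /eqP->; rewrite add1n.
Qed.

Definition cube_embedding (G : sgraph) n (f : G -> 'I_n -> bool) : Prop :=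
  forall x y, dist x y = hamming (f x) (f y).

Lemma partial_cube_embedding (G : sgraph) :
  partial_cube G -> exists n (f : G -> 'I_n -> bool), cube_embedding f.
Proof.
case=> n [H [isoH [phi phi_iso]]].
exists n, (fun x => (val (phi x) : {ffun 'I_n -> bool})) => x y.
by rewrite -dist_hypercube -isoH isomorphism_dist.
Qed.

(** * Coordinates, Theta-classes and semicubes *)

Section Embedding.
Variables (G : sgraph) (n : nat) (f : G -> 'I_n -> bool).
Hypotheses (G_connected : connected G) (f_embedding : cube_embedding f).

Lemma embedding_eq x y : f x =1 f y -> x = y.
Proof.
move=> eq_f; apply/eqP; rewrite -dist_eq0 f_embedding /hamming big1 // => k _.
by rewrite eq_f eqxx.
Qed.

Lemma adj_coordinate x y : adj x y ->
  exists2 i, f x i != f y i & forall k, k != i -> f x k = f y k.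
Proof.
rewrite -dist_eq1 f_embedding => /eqP d1.
have [i neq_i] : exists i, f x i != f y i.
  apply/existsP; apply: contra_eqT d1; rewrite negb_exists => /forallP eq_f.
  by rewrite /hamming big1 // => k _; rewrite (negbTE (eq_f k)).
exists i => // k neq_ki; apply/eqP/negPn/negP => neq_k.
by move: d1; rewrite /hamming (bigD1 i) //= (bigD1 k) //= neq_i neq_k.
Qed.

Lemma adj_other_coordinate x y i k :
  adj x y -> f x i != f y i -> k != i -> f x k = f y k.
Proof.
case/adj_coordinate=> j _ eq_f neq_i neq_ki; apply: (eq_f k).
by apply: contraNneq neq_i => eq_kj; rewrite eq_f // -eq_kj eq_sym.
Qed.

(** The ends of the edge agree outside [i], so only the terms at [i] decide which end is closer. *)
Lemma closerE x y i : adj x y -> f x i != f y i ->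
  closer x y = [set a | f a i == f x i].
Proof.
move=> xy neq_i; apply/setP => a; rewrite !inE !f_embedding /hamming.
rewrite (bigD1 i) // [ltnRHS](bigD1 i) //=.
under eq_bigr => k ki do rewrite (adj_other_coordinate xy neq_i ki).
by rewrite ltn_add2r; move: neq_i; do 3!case: (f _ i).
Qed.

Definition splits i (e : {set G}) : bool :=
  [exists x in e, exists y in e, f x i != f y i].

Lemma splits2 i x y : splits i [set x; y] = (f x i != f y i).
Proof.
apply/exists_inP/idP => [[u ux /exists_inP[v vx]]|neq_i].
  move: ux vx; rewrite !inE => /pred2P[] -> /pred2P[] ->; rewrite ?eqxx //.
  by rewrite eq_sym.
by exists x; rewrite ?set21 //; apply/exists_inP; exists y; rewrite ?set22.
Qed.

Definition cut i : {set {set G}} := [set e in edges G | splits i e].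

(** Excludes the coordinates crossed by no edge, whose empty cut is not a Theta-class. *)
Definition used i : bool := [exists e, e \in cut i].

Lemma mem_cut i x y : ([set x; y] \in cut i) = adj x y && (f x i != f y i).
Proof. by rewrite inE adj_in_edges splits2. Qed.

Lemma edge_cut e : e \in edges G -> exists i, e \in cut i.
Proof.
case/imsetP=> -[x y]; rewrite inE /= => xy ->.
by have [i neq_i _] := adj_coordinate xy; exists i; rewrite mem_cut xy.
Qed.

Lemma edgesP e :
  reflect (exists x y, adj x y /\ e = [set x; y]) (e \in edges G).
Proof.
apply: (iffP imsetP) => [[[x y]]|[x [y [xy ->]]]].
  by rewrite inE => xy ->; exists x, y.
by exists (x, y); rewrite ?inE.
Qed.

Lemma usedP i : reflect (exists x y, adj x y /\ f x i != f y i) (used i).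
Proof.
apply: (iffP existsP) => [[e]|[x [y [xy neq_i]]]].
  rewrite inE => /andP[/edgesP[x [y [xy ->]]]]; rewrite splits2 => neq_i.
  by exists x, y.
by exists [set x; y]; rewrite mem_cut xy.
Qed.

(** Off [i] the ends of [e] agree, so both sums in [theta] have equal terms there. At [i] the terms
    are equal exactly when the ends of the other edge agree; otherwise one is 0 and the other 2. *)
Lemma theta_edges e e' i : e \in cut i -> e' \in edges G ->
  theta e e' = (e' \in cut i).
Proof.
move=> e_cut e'_edge; apply/idP/idP.
  move=> /existsP[u /existsP[v /existsP[x /existsP[y]]]].
  case/and3P=> /eqP def_e /eqP def_e'; subst e e'.
  move: e_cut e'_edge; rewrite mem_cut adj_in_edges => /andP[uv uv_i] xy.
  rewrite mem_cut xy /=; apply: contraNneq => xy_i.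
  rewrite !f_embedding /hamming -!big_split; apply/eqP/eq_bigr => k _ /=.
  have [->|ki] := eqVneq k i; first by rewrite xy_i.
  by rewrite (adj_other_coordinate uv uv_i ki) addnC.
move: e_cut; rewrite inE => /andP[/edgesP[u [v [uv ->]]]].
rewrite splits2 => uv_i.
case/edgesP: e'_edge => x [y [xy ->]]; rewrite mem_cut xy /= => xy_i.
apply/existsP; exists u; apply/existsP; exists v.
apply/existsP; exists x; apply/existsP; exists y; rewrite !eqxx /=.
rewrite !f_embedding /hamming -!big_split (bigD1 i) //=.
rewrite [X in _ != X](bigD1 i) //=.
have -> : \sum_(k < n | k != i) ((f u k != f x k) + (f v k != f y k)) =
          \sum_(k < n | k != i) ((f u k != f y k) + (f v k != f x k)).
  by apply: eq_bigr => k ki; rewrite (adj_other_coordinate uv uv_i ki) addnC.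
by rewrite eqn_add2r; move: uv_i xy_i; do 4!case: (f _ i).
Qed.

(** A member of [equivalence_partition] consists of the edges related to a given edge; by
    [theta_edges] this is the whole cut of the coordinate which that edge crosses. *)
Lemma theta_classesP C :
  reflect (exists2 i, used i & C = cut i) (C \in theta_classes G).
Proof.
have class_cut e i : e \in cut i -> [set e' in edges G | theta e e'] = cut i.
  move=> e_cut; apply/setP => e'; rewrite inE [RHS]inE.
  by case e'_edge: (e' \in _); rewrite //= (theta_edges e_cut) // inE e'_edge.
apply: (iffP imsetP) => [[e e_edge ->]|[i /existsP[e e_cut] ->]].
  have [i e_cut] := edge_cut e_edge.
  by exists i; [apply/existsP; exists e | apply: class_cut].
exists e; last by rewrite (class_cut _ _ e_cut).
by move: e_cut; rewrite inE => /andP[].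
Qed.

(** The bit [b] comes from the orientation of the edge that [pick] happens to choose; [used i] rules
    out the default. *)
Lemma semicubes_cut i : used i -> exists b,
  semicubes (cut i) = ([set a | f a i == b], [set a | f a i == ~~ b]).
Proof.
case/usedP=> x [y [xy xy_i]]; rewrite /semicubes; case: pickP => [[u v] /=|].
  rewrite mem_cut => /andP[uv uv_i]; exists (f u i); congr (_, _).
    exact: closerE.
  rewrite (@closerE v u i) 1?adj_sym 1?eq_sym //; apply/setP => a.
  by rewrite !inE; move: uv_i; do 3!case: (f _ i).
by move/(_ (x, y)); rewrite /= mem_cut xy xy_i.
Qed.

Lemma opp_semicube_cut i x : used i ->
  opp_semicube (cut i) x = [set a | f a i != f x i].
Proof.
case/semicubes_cut=> b; rewrite /opp_semicube => -> /=.
rewrite inE; case: ifP => x_b; apply/setP => a; move: x_b; rewrite !inE;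
  by case: (f a i) (f x i) b => [] [] [].
Qed.

(** * Distance through the used coordinates *)

Lemma unused_const i x y : ~~ used i -> f x i = f y i.
Proof.
move=> unused_i; have /connectP[p] := G_connected x y.
elim: p x => [|z p IHp] x /=; first by move=> _ ->.
case/andP=> xz zp def_y; rewrite -(IHp z) //.
(* A change of coordinate [i] along one edge of the path would make [i] used. *)
by apply: contraNeq unused_i => neq_i; apply/usedP; exists x, z.
Qed.

Lemma dist_used (x y : G) : dist x y = \sum_(k | used k) (f x k != f y k).
Proof.
rewrite f_embedding /hamming (bigID used) /= [X in _ + X]big1 ?addn0 // => k.
by move=> unused_k; rewrite (unused_const x y unused_k) eqxx.
Qed.

Lemma dist_max (x y : G) : dist x y <= #|used|.
Proof. by rewrite dist_used -sum1_card leq_sum // => k _; case: (_ != _). Qed.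

Lemma dist_eq_max (x y : G) :
  reflect (forall k, used k -> f x k != f y k) (dist x y == #|used|).
Proof.
apply: (iffP idP) => [|opp_xy]; last first.
  by rewrite dist_used -sum1_card; apply/eqP/eq_bigr => k /opp_xy ->.
rewrite dist_used -sum1_card => + k used_k; apply: contraTN => eq_k.
(* The agreeing coordinate contributes 0 and each other at most 1, so the sum falls short of
   [#|used|]. *)
rewrite (bigD1 k) // [X in _ != X](bigD1 k) //= eq_k add0n neq_ltn ltnS.
by rewrite leq_sum // => j _; case: (_ != _).
Qed.

(** * Antipodes and the two implications *)

Lemma antipodeP (x : G) : even G -> absolute_antipode x (antipode x).
Proof.
(* An antipode exists, so [pick] succeeds and the default [x] is not returned. *)
by case/(_ x)=> y [xy _]; rewrite /antipode; case: pickP => // /(_ y); rewrite xy.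
Qed.

Lemma dist_diam (x y : G) : dist x y <= diam G.
Proof.
rewrite /diam; apply: leq_trans (leq_bigmax x).
by rewrite (leq_bigmax y).
Qed.

(* For an edge xy with antipodes x', y', uniqueness of antipodes gives
   d(x, y') < diam = d(y, y') and d(y, x') < diam = d(x, x'), so xy and x'y' are
   Theta-related and x, x' lie on opposite sides of their class; the set of
   classes separating z from z' is therefore the same for every z. *)
Lemma harmonic_even_antipode (x : G) i :
  harmonic_even G -> used i -> f (antipode x) i = ~~ f x i.
Proof.
case=> G_even [anti_bij anti_adj].
have dist_lt (u v : G) : adj u v -> dist u (antipode v) < dist v (antipode v).
  move=> uv; have /eqP-> := antipodeP v G_even.
  rewrite ltn_neqAle dist_diam andbT; apply/negP => u_v'.
  have [w [_ w_uniq]] := G_even u.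
  have /(bij_inj anti_bij) eq_uv : antipode u = antipode v.
    by rewrite -(w_uniq _ u_v') -(w_uniq _ (antipodeP u G_even)).
  by move: uv; rewrite eq_uv adj_irrefl.
have side (u v : G) k : adj u v -> f u k != f v k -> f (antipode v) k = f u k.
  move=> uv uv_k; have: antipode v \in closer u v by rewrite inE dist_lt.
  by rewrite (closerE uv uv_k) inE => /eqP.
have invariant (u v : G) k : adj u v ->
    (f (antipode u) k == f u k) = (f (antipode v) k == f v k).
  move=> uv; have [j uv_j _] := adj_coordinate uv.
  have v'_j := side _ _ _ uv uv_j.
  have u'_j : f (antipode u) j = f v j.
    by apply: side; rewrite 1?adj_sym 1?eq_sym.
  (* At [j] both tests compare [u] with [v]. Elsewhere neither [uv] nor the antipodal edge, which
     crosses [j] too, changes the coordinate. *)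
  have [->|kj] := eqVneq k j; first by rewrite v'_j u'_j eq_sym.
  rewrite (adj_other_coordinate uv uv_j kj).
  rewrite (@adj_other_coordinate (antipode u) (antipode v) j k) ?anti_adj //.
  by rewrite u'_j v'_j eq_sym.
case/usedP=> u [v [uv uv_i]].
have: f (antipode u) i != f u i.
  by rewrite (side v u) 1?adj_sym 1?eq_sym // eq_sym.
(* Invariance along a path carries the separation at [i] from the end [u] of a crossing edge to
   [x]. *)
have -> : (f (antipode u) i == f u i) = (f (antipode x) i == f x i).
  have /connectP[p + ->] := G_connected u x.
  elim: p u {uv uv_i} => //= w p IHp u /andP[uw wp].
  by rewrite (invariant _ _ _ uw) IHp.
by do 2!case: (f _ i).
Qed.

Lemma harmonic_even_opposite_semicube_isomorphic :
  harmonic_even G -> opposite_semicube_isomorphic G.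
Proof.
move=> G_harm C /theta_classesP[i used_i ->].
have [b ->] := semicubes_cut used_i.
apply: (@isomorphic_induced _ (@antipode G)) => [|x /=]; first exact: G_harm.2.
by rewrite !inE (harmonic_even_antipode _ G_harm used_i); case: b; case: (f x i).
Qed.

(* The semicubes of every class have size |V|/2, so W_i^*(x) and W_j^*(x) can
   only be disjoint when they are complementary, which forces i = j. *)
Lemma opp_semicubes_meet i j x : opposite_semicube_isomorphic G ->
  used i -> used j -> i != j ->
  opp_semicube (cut i) x :&: opp_semicube (cut j) x != set0.
Proof.
move=> G_iso used_i used_j neq_ij.
have half k : used k -> #|~: opp_semicube (cut k) x| = #|opp_semicube (cut k) x|.
  move=> used_k; have /G_iso/isomorphic_induced_card : cut k \in theta_classes G.
    by apply/theta_classesP; exists k.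
  rewrite opp_semicube_cut //; have [b ->] /= := semicubes_cut used_k.
  set A := [set a | _ == b]; set B := [set a | _ == ~~ b] => eq_AB.
  have compl : B = ~: A.
    by apply/setP => a; rewrite !inE; case: (f a k) (b) => [] [].
  have [-> | ->] : [set a | f a k != f x k] = A \/ [set a | f a k != f x k] = B.
  - have [eq_b|neq_b] := eqVneq b (f x k); [right | left]; apply/setP => a.
      by rewrite !inE -eq_b; case: (f a k) (b) => [] [].
    by move: neq_b; rewrite !inE; case: (f a k) (f x k) (b) => [] [] [].
  - by rewrite -compl.
  - by rewrite {1}compl setCK.
apply/negP => /eqP disj.
have sub : opp_semicube (cut i) x \subset ~: opp_semicube (cut j) x.
  by rewrite -disjoints_subset -setI_eq0 disj.
have eq_card : #|opp_semicube (cut i) x| = #|opp_semicube (cut j) x|.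
  (* Twice either cardinality is the number of vertices. *)
  apply: double_inj; rewrite -!addnn -{2}(half i used_i) -{2}(half j used_j).
  by rewrite !cardsC.
have /setP eq_opp : opp_semicube (cut i) x = ~: opp_semicube (cut j) x.
  by apply/eqP; rewrite eqEcard sub half //= eq_card.
have opp_eq z : (f z i != f x i) = (f z j == f x j).
  by have := eq_opp z; rewrite !opp_semicube_cut // !inE negbK.
(* Along an edge crossing [i] the left side of [opp_eq] changes, while the right side does not since
   the edge cannot also cross [j]. *)
case/usedP: used_i => u [v [uv uv_i]].
have uv_j : f u j = f v j.
  by apply: (adj_other_coordinate uv uv_i); rewrite eq_sym.
have := opp_eq v; rewrite -uv_j -opp_eq; move: uv_i.
by do 3!case: (f _ i).
Qed.

Lemma opposite_semicube_isomorphic_harmonic_even :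
  opposite_semicube_Helly G -> opposite_semicube_isomorphic G -> harmonic_even G.
Proof.
move=> G_Helly G_iso.
have opp (x : G) : exists y, dist x y == #|used|.
  have /set0Pn[y /bigcapP y_opp] :
      \bigcap_(C in theta_classes G) opp_semicube C x != set0.
    apply: G_Helly => C D /theta_classesP[i used_i ->].
    case/theta_classesP=> j used_j -> neq_ij.
    by apply: opp_semicubes_meet => //; apply: contraNneq neq_ij => ->.
  (* A vertex in all opposite semicubes differs from [x] in every used coordinate. *)
  exists y; apply/dist_eq_max => k used_k; rewrite eq_sym.
  have := y_opp (cut k); rewrite opp_semicube_cut // inE; apply.
  by apply/theta_classesP; exists k.
have diamE (x : G) : diam G = #|used|.
  apply/eqP; rewrite eqn_leq; apply/andP; split.
    by apply/bigmax_leqP => u _; apply/bigmax_leqP => v _; apply: dist_max.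
  by have [y /eqP <-] := opp x; apply: dist_diam.
have G_even : even G.
  move=> x; have [y xy] := opp x; exists y; rewrite /absolute_antipode (diamE x).
  (* Coordinates are boolean: the used ones of an antipode are forced to be the negations of those
     of [x], and the others are constant. *)
  split=> // z xz; apply: embedding_eq => k.
  have [used_k|] := boolP (used k); last exact: unused_const.
  move/dist_eq_max/(_ k used_k): xz; move/dist_eq_max/(_ k used_k): xy.
  by do 3!case: (f _ k).
have anti_opp x k : used k -> f (antipode x) k = ~~ f x k.
  have := antipodeP x G_even; rewrite /absolute_antipode (diamE x).
  by move/dist_eq_max => x_opp /x_opp; do 2!case: (f _ k).
have anti_dist (x y : G) : dist (antipode x) (antipode y) = dist x y.
  rewrite !dist_used; apply: eq_bigr => k used_k; rewrite !anti_opp //.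
  by do 2!case: (f _ k).
split=> //; split; last by move=> x y; rewrite -!dist_eq1 anti_dist.
(* A distance-preserving self-map is injective, hence bijective on a finite graph. *)
apply: injF_bij => x y eq_xy; apply/eqP.
by rewrite -dist_eq0 -anti_dist eq_xy dist_eq0.
Qed.

End Embedding.

Theorem corollary5p5 (G : sgraph) (G_connected : connected G)
    (G_partial_cube : partial_cube G) (G_Helly : opposite_semicube_Helly G) :
  harmonic_even G <-> opposite_semicube_isomorphic G.
Proof.
have [n [f f_embedding]] := partial_cube_embedding G_partial_cube; split.
  exact: (harmonic_even_opposite_semicube_isomorphic G_connected f_embedding).
exact: (opposite_semicube_isomorphic_harmonic_even G_connected f_embedding).
Qed.
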